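(* Consider any $q\in\mathbb R^n$ with positive entries such that $\mathrm{diag}(r)^{-1}\mathbf P\,\mathrm{diag}(r)^{-1}\preceq\mathrm{diag}(q)^{-1}$, and consider SVRCDG (defined in the context, together with $p,r,\mathbf P$) with stepsize $\alpha=\min_{i,j}\frac1{4\frac{m_i^j}{p_iq_jn}+\frac1\rho\sigma}$. Then its iteration complexity is $\max_{i,j}\left(4\frac{m_i^j}{\sigma np_iq_j}+\frac1\rho\right)\log\frac1\epsilon$; that is, there exists $\beta>0$ such that, with $$\Psi^k=\|x^k-x^*\|^2+\alpha\beta^2\sum_{i=1}^d\sum_{j=1}^n(m_i^j)^\dagger\left(\mathbf J_{ij}^k-\nabla_if_j(x^* )\right)^2,$$ where $t^\dagger=1/t$ for $t>0$ and $0^\dagger=0$, for every $\epsilon\in(0,1)$ and every integer $k\ge\max_{i,j}\left(4\frac{m_i^j}{\sigma np_iq_j}+\frac1\rho\right)\log\frac1\epsilon$ we have $\mathbb E[\Psi^k]\le\epsilon\,\Psi^0$.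
   Context: Problem. $f_1,\dots,f_n:\mathbb R^d\to\mathbb R$ are differentiable and convex, $f=\frac1n\sum_{j=1}^n f_j$, $\psi:\mathbb R^d\to\mathbb R\cup\{+\infty\}$ is proper, closed and convex. $\min_x f(x)+\psi(x)$ has a unique minimizer $x^*$, and $f$ is $\sigma$-quasi strongly convex with $\sigma>0$: $f(x^* )\ge f(y)+\langle\nabla f(y),x^*-y\rangle+\frac\sigma2\|y-x^*\|^2$ for all $y$. Each $f_j$ is $\mathbf M_j$-smooth with $\mathbf M_j=\mathrm{diag}(m^j)\succeq0$ diagonal, where $m^j=(m_1^j,\dots,m_d^j)\in\mathbb R^d$ has nonnegative entries: $f_j(x)\le f_j(y)+\langle\nabla f_j(y),x-y\rangle+\frac12\sum_im_i^j(x_i-y_i)^2$ for all $x,y$. $\mathrm{prox}_{\alpha\psi}(x)=\arg\min_u\{\alpha\psi(u)+\frac12\|u-x\|^2\}$; $\nabla_i$ denotes the $i$-th partial derivative; $\preceq$ is the Loewner order; $\mathrm{diag}(v)$ is the diagonal matrix with diagonal $v$; $\mathbf G(x)=[\nabla f_1(x),\dots,\nabla f_n(x)]\in\mathbb R^{d\times n}$. Samplings. $L\subseteq[d]$ and $R\subseteq[n]$ are independent random subsets with $p_i=\mathbb P(i\in L)>0$ for all $i$, $r_j=\mathbb P(j\in R)>0$ for all $j$; $p=(p_i)$, $r=(r_j)$; $\mathbf P\in\mathbb R^{n\times n}$ has entries $\mathbf P_{jj'}=\mathbb P(j\in R,\,j'\in R)$; $\rho\in(0,1]$. Algorithm (SVRCDG).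 Given $x^0\in\mathbb R^d$, set $\mathbf J^0=0\in\mathbb R^{d\times n}$. For $k=0,1,2,\dots$: draw $L^k$ (copy of $L$) and $R^k$ (copy of $R$), independent of each other and of the past; define $g^k\in\mathbb R^d$ by $g_i^k=\frac1n\sum_{j=1}^n\mathbf J_{ij}^k+\frac1n\sum_{j\in R^k}\frac{\mathbf 1[i\in L^k]}{p_ir_j}\left(\nabla_if_j(x^k)-\mathbf J_{ij}^k\right)$; $x^{k+1}=\mathrm{prox}_{\alpha\psi}(x^k-\alpha g^k)$; independently, set $\mathbf J^{k+1}=\mathbf G(x^k)$ with probability $\rho$ and $\mathbf J^{k+1}=\mathbf J^k$ with probability $1-\rho$.
   Formalization: Added hypothesis: ∇_i f_j(x* ) = 0 whenever m_i^j = 0. Without it the claim fails: d=1, n=3, f_j = x²/2, x, −x, ψ=0, R a uniform singleton, x^0 = x* = 0 gives Ψ^0 = 0 but E[Ψ^k] > 0. *)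

(* Defs.v *)
From HB Require Import structures.
From mathcomp Require Import all_boot all_order all_algebra.
From mathcomp Require Import all_classical all_reals all_analysis.

Set Implicit Arguments.
Unset Strict Implicit.
Unset Printing Implicit Defensive.

Import Order.TTheory GRing.Theory Num.Theory.
Import numFieldNormedType.Exports.

Local Open Scope classical_set_scope.
Local Open Scope ring_scope.

(* Vectors of R^d are row vectors.  The library norm `|x| on 'rV[R]_d is the
   sup norm, so the Euclidean structure is spelled out. *)

Section EuclideanSpace.
Context {R : realType} {d : nat}.
Implicit Types (x y u : 'rV[R]_d) (f : 'rV[R]_d -> R).

Definition dot x y : R := \sum_i x 0 i * y 0 i.

Definition sqnorm x : R := dot x x.

Definition partial (i : 'I_d) f x : R := 'D_(delta_mx 0 i) f x.

Definition grad f x : 'rV[R]_d := \row_i partial i f x.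

(* f is M-smooth for M = diag(m). *)
Definition diag_smooth (m : 'I_d -> R) f : Prop :=
  forall x y, f x <= f y + dot (grad f y) (x - y)
                     + 2^-1 * \sum_i m i * (x 0 i - y 0 i) ^+ 2.

Definition quasi_strongly_convex (sigma : R) f (xstar : 'rV[R]_d) : Prop :=
  forall y, f y + dot (grad f y) (xstar - y)
            + sigma / 2 * sqnorm (y - xstar) <= f xstar.

(* Functions with values in R u {+oo}: \bar R-valued, never -oo. *)
Definition proper_fun (psi : 'rV[R]_d -> \bar R) : Prop :=
  (forall x, psi x != -oo%E) /\ exists x, psi x \is a fin_num.

Definition closed_fun (psi : 'rV[R]_d -> \bar R) : Prop :=
  closed [set z : 'rV[R]_d * R | (psi z.1 <= z.2%:E)%E].

Definition convex_fun (psi : 'rV[R]_d -> \bar R) : Prop :=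
  forall x y (t : R), 0 <= t <= 1 ->
    (psi (t *: x + (1 - t) *: y)%R <= t%:E * psi x + (1 - t)%:E * psi y)%E.

Definition argmin (F : 'rV[R]_d -> \bar R) : set 'rV[R]_d :=
  [set x | forall y, (F x <= F y)%E].

(* "y = prox_(alpha psi)(x)" is rendered as [prox alpha psi x y]: y attains the
   minimum that defines the proximal point. *)
Definition prox (alpha : R) (psi : 'rV[R]_d -> \bar R) x : set 'rV[R]_d :=
  argmin (fun u => alpha%:E * psi u + (2^-1 * sqnorm (u - x)%R)%:E)%E.

End EuclideanSpace.

Section FiniteSum.
Context {R : realType} {d n : nat}.
Implicit Types (f : 'I_n -> 'rV[R]_d -> R) (m : 'I_n -> 'I_d -> R).

Definition average f : 'rV[R]_d -> R := fun x => n%:R^-1 * \sum_j f j x.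

Definition Jac f (x : 'rV[R]_d) : 'M[R]_(d, n) :=
  \matrix_(i, j) partial i (f j) x.

(* Column j of A lies in the range of diag(m j), for every j.  Entries outside
   these ranges have weight 0 in [lyapunov]: if J^0 - Jac f x* had such entries,
   E[Psi^k] <= eps Psi^0 could fail, as J^0 stays in use with probability
   (1 - rho)^k. *)
Definition in_range m (A : 'M[R]_(d, n)) : Prop :=
  forall i j, m j i = 0 -> A i j = 0.

(* 0^-1 = 0 in MathComp, so (m j i)^-1 is the pseudo-inverse of m j i. *)
Definition lyapunov f m (xstar : 'rV[R]_d) (alpha beta : R)
    (x : 'rV[R]_d) (J : 'M[R]_(d, n)) : R :=
  sqnorm (x - xstar)
  + alpha * beta ^+ 2 *
    \sum_i \sum_j (m j i)^-1 * (J i j - partial i (f j) xstar) ^+ 2.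

End FiniteSum.

Definition diag_of {R : realType} {n : nat} (v : 'I_n -> R) : 'M[R]_n :=
  diag_mx (\row_j v j).

Definition loewner_le {R : realType} {n : nat} (A B : 'M[R]_n) : Prop :=
  forall v : 'rV[R]_n, 0 <= (v *m (B - A) *m v^T) 0 0.

Section Sampling.
Context {disp : measure_display} {T : measurableType disp} {R : realType}.
Variable P : probability T R.

Definition prob (A : set T) : R := fine (P A).

Definition finite_rv {V : finType} (X : T -> V) : Prop :=
  forall B : set V, measurable (X @^-1` B).

Definition independent_rv {V W : finType} (X : T -> V) (Y : T -> W) : Prop :=
  forall (A : set V) (B : set W),
    prob (X @^-1` A `&` Y @^-1` B) = prob (X @^-1` A) * prob (Y @^-1` B).

Definition same_law {V : finType} (X Y : T -> V) : Prop :=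
  forall B : set V, prob (X @^-1` B) = prob (Y @^-1` B).

Definition incl_prob {n : nat} (S : T -> {set 'I_n}) (j : 'I_n) : R :=
  prob [set w | j \in S w].

Definition prob_matrix {n : nat} (S : T -> {set 'I_n}) : 'M[R]_n :=
  \matrix_(j, j') prob [set w | (j \in S w) && (j' \in S w)].

(* Mutual independence of the family of all X k, Y k, Z k (k : nat).  Taking
   A k, B k or C k to be setT gives the product rule over every finite
   subfamily. *)
Definition independent_draws {U V W : finType}
    (X : nat -> T -> U) (Y : nat -> T -> V) (Z : nat -> T -> W) : Prop :=
  forall (s : seq nat) (A : nat -> set U) (B : nat -> set V) (C : nat -> set W),
    uniq s ->
    prob [set w | forall k, k \in s -> [/\ A k (X k w), B k (Y k w) & C k (Z k w)]]
    = \prod_(k <- s) (prob (X k @^-1` A k) * prob (Y k @^-1` B k)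
                      * prob (Z k @^-1` C k)).

End Sampling.

Section SVRCDG.
Context {disp : measure_display} {T : measurableType disp} {R : realType}.
Context {d n : nat}.
Variable P : probability T R.
Implicit Types (f : 'I_n -> 'rV[R]_d -> R) (psi : 'rV[R]_d -> \bar R).

Definition grad_estimator f (p : 'I_d -> R) (r : 'I_n -> R)
    (x : 'rV[R]_d) (J : 'M[R]_(d, n)) (L : {set 'I_d}) (S : {set 'I_n}) :
    'rV[R]_d :=
  \row_i (n%:R^-1 * \sum_j J i j
          + n%:R^-1 * \sum_(j in S)
              (i \in L)%:R / (p i * r j) * (partial i (f j) x - J i j)).

(* (Lk k, Sk k, Ck k) are the draws of iteration k: Lk k and Sk k are copies of
   the samplings L and S of [d] and [n], and the coin Ck k decides whether the
   Jacobian estimate is refreshed. *)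
Record svrcdg f psi (alpha rho : R) (L : T -> {set 'I_d}) (S : T -> {set 'I_n})
    (x0 : 'rV[R]_d) (Lk : nat -> T -> {set 'I_d}) (Sk : nat -> T -> {set 'I_n})
    (Ck : nat -> T -> bool)
    (x : nat -> T -> 'rV[R]_d) (J : nat -> T -> 'M[R]_(d, n)) : Prop := {
  svrcdg_Lk_rv : forall k, finite_rv (Lk k);
  svrcdg_Sk_rv : forall k, finite_rv (Sk k);
  svrcdg_Ck_rv : forall k, finite_rv (Ck k);
  svrcdg_Lk_law : forall k, same_law P (Lk k) L;
  svrcdg_Sk_law : forall k, same_law P (Sk k) S;
  svrcdg_Ck_law : forall k, prob P [set w | Ck k w] = rho;
  svrcdg_indep : independent_draws P Lk Sk Ck;
  svrcdg_x0 : forall w, x 0%N w = x0;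
  svrcdg_J0 : forall w, J 0%N w = 0;
  svrcdg_x : forall k w,
    prox alpha psi
      (x k w - alpha *: grad_estimator f (incl_prob P L) (incl_prob P S)
                          (x k w) (J k w) (Lk k w) (Sk k w))
      (x k.+1 w);
  svrcdg_J : forall k w,
    J k.+1 w = if Ck k w then Jac f (x k w) else J k w
}.

End SVRCDG.

Section Extrema.
Context {R : realType} {d n : nat}.
Implicit Type F : 'I_d.+1 -> 'I_n.+1 -> R.

(* The neutral elements are themselves among the values of F. *)
Definition min2 F : R :=
  \big[Num.min/F ord0 ord0]_(ij : 'I_d.+1 * 'I_n.+1) F ij.1 ij.2.

Definition max2 F : R :=
  \big[Num.max/F ord0 ord0]_(ij : 'I_d.+1 * 'I_n.+1) F ij.1 ij.2.

End Extrema.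

(* Main.v *)
Require Import Defs.
From mathcomp Require Import all_boot all_order all_algebra.
From mathcomp Require Import all_classical all_reals all_analysis.
From mathcomp Require Import measurable_realfun ring lra.
Import Order.TTheory GRing.Theory Num.Theory.
Import numFieldNormedType.Exports.
Local Open Scope classical_set_scope.
Local Open Scope ring_scope.

Set Implicit Arguments.
Unset Strict Implicit.
Unset Printing Implicit Defensive.

(* Write z = x - alpha g and z' = x* - alpha grad f(x* ).  Since x* is the
   proximal point of z' and the prox is nonexpansive, |x+ - x*| <= |z - z'|.
   Split g - grad f(x* ) into a sampled estimate of G(x) - G(x* ) and the
   centred sampling noise of J - G(x* ); by |s + t|^2 <= 2|s|^2 + 2|t|^2 and the
   bound on diag(r)^-1 P diag(r)^-1, its second moment is at most
   2/n^2 sum_ij ((G(x) - G(x* ))_ij^2 + (J - G(x* ))_ij^2) / (p_i q_j).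
   Cocoercivity of the M_j-smooth convex f_j bounds the first part by the
   Bregman divergence of f, the stepsize turns the weights 1 / (p_i q_j) into
   pseudo-inverses of m_i^j, and beta^2 = 1 / (2 n rho) makes the Lyapunov
   function contract in mean by 1 - alpha sigma.  Only finitely many histories
   of draws exist up to step k, so all expectations are finite sums over
   histories. *)

(** * Convexity, smoothness and proximal points *)

Section EuclideanGeometry.
Context {R : realType} {d : nat}.
Implicit Types x y z : 'rV[R]_d.

Lemma dotC x y : dot x y = dot y x.
Proof. by apply: eq_bigr => i _; rewrite mulrC. Qed.

Lemma dotDl x y z : dot (x + y) z = dot x z + dot y z.
Proof. by rewrite -big_split; apply: eq_bigr => i _; rewrite mxE mulrDl. Qed.

Lemma dotZl (a : R) x y : dot (a *: x) y = a * dot x y.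
Proof. by rewrite mulr_sumr; apply: eq_bigr => i _; rewrite mxE mulrA. Qed.

Lemma dotNl x y : dot (- x) y = - dot x y.
Proof. by rewrite -scaleN1r dotZl mulN1r. Qed.

Lemma dotDr x y z : dot x (y + z) = dot x y + dot x z.
Proof. by rewrite dotC dotDl !(dotC _ x). Qed.

Lemma dotZr (a : R) x y : dot x (a *: y) = a * dot x y.
Proof. by rewrite dotC dotZl dotC. Qed.

Lemma dotNr x y : dot x (- y) = - dot x y.
Proof. by rewrite dotC dotNl dotC. Qed.

Definition dotE := (dotDl, dotDr, dotNl, dotNr, dotZl, dotZr).

Lemma sqnorm_ge0 x : 0 <= sqnorm x.
Proof. by apply: sumr_ge0 => i _; rewrite -expr2 sqr_ge0. Qed.

Lemma sqnorm0 : sqnorm (0 : 'rV[R]_d) = 0.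
Proof. by apply: big1 => i _; rewrite mxE mul0r. Qed.

Lemma sqnorm_eq0 x : sqnorm x = 0 -> x = 0.
Proof.
move=> x0; apply/rowP => i; rewrite mxE; apply/eqP.
rewrite -sqrf_eq0 expr2.
by move/eqP: x0; rewrite psumr_eq0 => [/allP/(_ i)|j _];
  [rewrite mem_index_enum => /(_ isT)|rewrite -expr2 sqr_ge0].
Qed.

Lemma sqnormB x y : sqnorm (x - y) = sqnorm x - 2 * dot x y + sqnorm y.
Proof. by rewrite /sqnorm !dotE (dotC y x); ring. Qed.

Lemma sqnorm_sumsq x : sqnorm x = \sum_i x 0 i ^+ 2.
Proof. by apply: eq_bigr => i _; rewrite expr2. Qed.

End EuclideanGeometry.

(* Spares a passage to the limit t -> 0 in the optimality conditions. *)
Lemma first_order_ge0 (R : realFieldType) (a C : R) :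
  (forall t : R, 0 < t <= 1 -> 0 <= t * a + t ^+ 2 * C) -> 0 <= a.
Proof.
move=> H; rewrite leNgt; apply/negP => a0.
have D0 : 0 < `|C| + 1 - a by have := normr_ge0 C; lra.
pose t := - a / (`|C| + 1 - a).
have t0 : 0 < t by rewrite divr_gt0// oppr_gt0.
have t1 : t <= 1 by rewrite ler_pdivrMr// mul1r; have := normr_ge0 C; lra.
have := H t; rewrite t0 t1 => /(_ isT).
rewrite expr2 -mulrA -mulrDr pmulr_rge0// => aC.
have tE : t * (`|C| + 1 - a) = - a by rewrite divfK ?gt_eqF.
have : t * C <= t * `|C| by rewrite ler_pM2l// ler_norm.
have : 0 < t * (1 - a) by rewrite mulr_gt0//; lra.
by nra.
Qed.

Section ConvexSmooth.
Context {R : realType} {d : nat}.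
Implicit Types (x y z u v : 'rV[R]_d) (f : 'rV[R]_d -> R).

Lemma derive_dot_grad f x v : differentiable f x -> 'D_v f x = dot (grad f x) v.
Proof.
move=> df; rewrite deriveE// {1}(row_sum_delta v) linear_sum.
by apply: eq_bigr => i _; rewrite linearZ mxE /partial deriveE// mulrC.
Qed.

(** Convexity bounds every difference quotient from [x] towards [y] with step in (0, 1] by
    [f y - f x]; the directional derivative is their limit from the right. *)
Lemma convex_function_ge f x y :
  differentiable f x -> convex_function setT f ->
  f x + dot (grad f x) (y - x) <= f y.
Proof.
move=> df cf; rewrite -derive_dot_grad// addrC -lerBrDr.
have dd : derivable f x (y - x) by exact: diff_derivable.
have cR : h^-1 *: ((f \o shift x) (h *: (y - x)) - f x) @[h --> 0^'+]
    --> 'D_(y - x) f x by exact/cvg_dnbhs_at_right.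
rewrite -(cvg_lim (@Rhausdorff R) cR); apply: limr_le.
  by apply/cvg_ex; exists ('D_(y - x) f x).
near=> h.
have h0 : 0 < h by near: h; exact: nbhs_right_gt.
have h1 : h <= 1 by near: h; exact: nbhs_right_le.
have := cf (Itv01 (ltW h0) h1) y x; rewrite !in_setT => /(_ isT isT).
rewrite convRE /= /unstable.onem => cv.
rewrite /GRing.scale/= mulrC ler_pdivrMr//.
suff -> : h *: (y - x) + x = h *: y + (1 - h) *: x.
  apply: le_trans (_ : h * f y + (1 - h) * f x - f x <= _); last by lra.
  by rewrite lerD2r.
by rewrite scalerBr scalerBl scale1r -!addrA (addrC x).
Unshelve. all: by end_near.
Qed.

(* Evaluate smoothness at x and the first-order lower bound at y at the common
   point x - v. *)
Lemma bregman_ge (m : 'I_d -> R) f x y v :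
    differentiable f y -> convex_function setT f -> diag_smooth m f ->
  dot (grad f x - grad f y) v - 2^-1 * \sum_i m i * v 0 i ^+ 2
  <= f x - f y - dot (grad f y) (x - y).
Proof.
move=> df cf sf.
have := convex_function_ge (x - v) df cf.
have := sf (x - v) x.
rewrite (_ : \sum_i _ = \sum_i m i * v 0 i ^+ 2); last first.
  by apply: eq_bigr => i _; rewrite !mxE addrAC subrr sub0r sqrrN.
by rewrite !dotE; lra.
Qed.

(** With [m i = 0] the quadratic term of [bregman_ge] vanishes along coordinate [i], leaving a
    linear lower bound on a fixed number, so its slope must be 0. *)
Lemma grad_eq_of_m0 (m : 'I_d -> R) f x y i :
    differentiable f y -> convex_function setT f -> diag_smooth m f ->
  m i = 0 -> partial i f x = partial i f y.
Proof.
move=> df cf sf mi0; apply/eqP; rewrite -subr_eq0; apply/negPn/negP => ne.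
set e := partial i f x - partial i f y in ne.
set D := f x - f y - dot (grad f y) (x - y).
(* This step length makes the linear term equal to [D + 1], exceeding its upper bound [D]. *)
have := bregman_ge x (((D + 1) / e) *: delta_mx 0 i) df cf sf.
rewrite (bigD1 i)//= mi0 mul0r add0r big1 => [|j ji]; last first.
  by rewrite !mxE (negPf ji) andbF mulr0 expr0n mulr0.
rewrite /dot (bigD1 i)//= big1 => [|j ji]; last first.
  by rewrite !mxE (negPf ji) andbF !mulr0.
rewrite !mxE !eqxx mulr1 -/e mulrCA mulfV// -/D.
by lra.
Qed.

Lemma bregman_ge_cocoercive (m : 'I_d -> R) f x y :
    differentiable f y -> convex_function setT f -> diag_smooth m f ->
  2^-1 * \sum_i (m i)^-1 * (partial i f x - partial i f y) ^+ 2
  <= f x - f y - dot (grad f y) (x - y).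
Proof.
move=> df cf sf.
(* The maximiser of the bound in [bregman_ge] where [m i > 0]; where [m i = 0] the convention
   [0^-1 = 0] makes both sides vanish. *)
pose v : 'rV[R]_d := \row_i ((m i)^-1 * (partial i f x - partial i f y)).
apply: le_trans (bregman_ge x v df cf sf); rewrite le_eqVlt; apply/orP; left.
apply/eqP; rewrite /dot !mulr_sumr -sumrB; apply: eq_bigr => i _; rewrite !mxE.
have [->|m0] := eqVneq (m i) 0; first by rewrite invr0; ring.
by field.
Qed.

End ConvexSmooth.

Lemma partial_average (R : realType) (d n : nat) (f : 'I_n -> 'rV[R]_d -> R)
    (x : 'rV[R]_d) (i : 'I_d) :
  (forall j, differentiable (f j) x) ->
  partial i (average f) x = n%:R^-1 * \sum_j partial i (f j) x.
Proof.
move=> df.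
have dd j : derivable (f j) x (delta_mx 0 i) by exact: diff_derivable.
have -> : average f = n%:R^-1 \*: \sum_j f j.
  by apply/funext => y; rewrite /average /= fct_sumE.
by rewrite /partial deriveZ ?derive_sum//; exact: derivable_sum.
Qed.

(** * Optimality conditions and nonexpansiveness of the prox *)

Section Prox.
Context {R : realType} {d : nat}.
Implicit Types (x y z u : 'rV[R]_d) (psi : 'rV[R]_d -> \bar R).

Lemma fin_numP psi (psi_proper : proper_fun psi) u a :
  (psi u <= a%:E)%E -> psi u \is a fin_num.
Proof.
move=> ua; rewrite fin_numE psi_proper.1/=.
by rewrite -ltey (le_lt_trans ua) ?ltry.
Qed.

(** Covers both the prox objective and the optimality of [xstar]. Comparing [y] with
    [t u + (1 - t) y] and using convexity of [psi] gives an inequality in [t] whose linear part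
    survives by [first_order_ge0]. *)
Lemma argmin_smooth_subgrad (F : 'rV[R]_d -> R) psi y (g : 'rV[R]_d)
    (Q : 'rV[R]_d -> R) (c : R) :
    proper_fun psi -> convex_fun psi -> 0 < c ->
    (forall u (t : R), 0 < t <= 1 ->
      F (t *: u + (1 - t) *: y) <= F y + t * dot g (u - y) + t ^+ 2 * Q u) ->
    argmin (fun u => c%:E * psi u + (F u)%:E)%E y ->
  psi y \is a fin_num /\
  forall u, psi u \is a fin_num ->
    0 <= c * (fine (psi u) - fine (psi y)) + dot g (u - y).
Proof.
move=> pp cp c0 FQ ymin; have [u0 fu0] := pp.2.
(* An infinite value at [y] would exceed the finite value at [u0]. *)
have fy : psi y \is a fin_num.
  have /(_ u0) := ymin; rewrite -(fineK fu0) -EFinM -EFinD.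
  have := pp.1 y; case: (psi y) => [a||]//=.
  by rewrite gt0_muley ?lte_fin.
split=> // u fu; apply: (@first_order_ge0 _ _ (Q u)) => t t01.
have [t0 t1] := andP t01.
have := cp u y t; rewrite (ltW t0) t1 => /(_ isT).
rewrite -(fineK fu) -(fineK fy) -!EFinM -EFinD => cv.
have fz := fin_numP pp cv.
have /(_ (t *: u + (1 - t) *: y)) := ymin.
move: cv; rewrite -(fineK fz) -(fineK fy) -!EFinM -!EFinD !lee_fin.
have := FQ u t t01.
set b := fine (psi u); set a := fine (psi y); set a' := fine (psi _).
move=> h1 /= h2 h3.
have : c * a' <= c * (t * b + (1 - t) * a) by rewrite ler_pM2l.
by lra.
Qed.

Lemma prox_subgrad psi (alpha : R) z y :
    proper_fun psi -> convex_fun psi -> 0 < alpha -> prox alpha psi z y ->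
  psi y \is a fin_num /\
  forall u, psi u \is a fin_num ->
    0 <= alpha * (fine (psi u) - fine (psi y)) + dot (y - z) (u - y).
Proof.
move=> pp cp a0 py.
apply: (@argmin_smooth_subgrad (fun u => 2^-1 * sqnorm (u - z)) _ _ _
  (fun u => 2^-1 * sqnorm (u - y))) => // u t t01.
rewrite (_ : _ - z = (y - z) + t *: (u - y)); last first.
  by apply/rowP => i; rewrite !mxE; ring.
by rewrite /sqnorm !dotE (dotC y z) (dotC u z) (dotC u y); lra.
Qed.

(** The last hypothesis says that [-h] is a subgradient of [psi] at [xs], so that [xs] is the
    proximal point of [xs - alpha h]. Adding the two subgradient inequalities cancels [psi] and
    leaves [h1]; expanding a square then concludes. *)
Lemma prox_nonexpansive psi (alpha : R) z y (xs h : 'rV[R]_d) :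
    proper_fun psi -> convex_fun psi -> 0 < alpha -> prox alpha psi z y ->
    psi xs \is a fin_num ->
    (forall u, psi u \is a fin_num ->
      0 <= fine (psi u) - fine (psi xs) + dot h (u - xs)) ->
  sqnorm (y - xs) <= sqnorm (z - (xs - alpha *: h)).
Proof.
move=> pp cp a0 py fxs hxs.
have [fy /(_ _ fxs) hy] := prox_subgrad pp cp a0 py.
have := hxs _ fy; rewrite -(pmulr_rge0 _ a0) => hx.
set w := z - (xs - alpha *: h).
have h1 : sqnorm (y - xs) <= dot w (y - xs).
  move: hx hy; rewrite /w /sqnorm !dotE (dotC xs y); lra.
have := sqnorm_ge0 (w - (y - xs)); rewrite sqnormB; lra.
Qed.

Lemma prox_uniq psi (alpha : R) z y y' :
    proper_fun psi -> convex_fun psi -> 0 < alpha ->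
    prox alpha psi z y -> prox alpha psi z y' ->
  y = y'.
Proof.
move=> pp cp a0 py py'.
have [fy' hy'] := prox_subgrad pp cp a0 py'.
apply/eqP; rewrite -subr_eq0; apply/eqP/sqnorm_eq0/le_anti.
rewrite sqnorm_ge0 andbT.
(* This choice of [h] gives [y' - alpha h = z], so the bound on the distance is 0. *)
have := @prox_nonexpansive _ _ z y y' (alpha^-1 *: (y' - z)) pp cp a0 py fy'.
rewrite scalerA divff ?gt_eqF// scale1r subKr subrr.
rewrite sqnorm0; apply=> u fu; rewrite dotZl -(pmulr_rge0 _ a0) mulrDr mulrA.
rewrite divff ?gt_eqF// mul1r.
exact: hy'.
Qed.

End Prox.

(** * Finite random variables and histories of draws *)

Section FiniteRandomVariables.
Context {disp : measure_display} {T : measurableType disp} {R : realType}.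
Variable P : probability T R.

Lemma prob_ge0 (A : set T) : 0 <= prob P A.
Proof. by rewrite fine_ge0. Qed.

Lemma probK (A : set T) : measurable A -> (prob P A)%:E = P A.
Proof. by move=> mA; rewrite fineK// fin_num_measure. Qed.

Lemma probT : prob P setT = 1.
Proof. by rewrite /prob probability_setT. Qed.

Lemma probC (A : set T) : measurable A -> prob P (~` A) = 1 - prob P A.
Proof.
by move=> mA; rewrite /prob probability_setC// fineB ?fin_num_measure.
Qed.

(** Supplies an outcome realising a given history, at which the relations of the algorithm can be
    read off. *)
Lemma prob_neq0_ex (A : set T) : prob P A != 0 -> exists w, A w.
Proof.
move=> PA; apply/set0P; apply: contra_neq PA => ->.
by rewrite /prob measure0.
Qed.

Lemma finite_rv_singletons (V : finType) (X : T -> V) :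
  (forall v, measurable (X @^-1` [set v])) -> finite_rv X.
Proof.
move=> mX B; have -> : X @^-1` B = \bigcup_(v in B) X @^-1` [set v].
  by apply/seteqP; split=> [w Bw|w [v Bv /= ->]]//; exists (X w).
by apply: fin_bigcup_measurable => //; exact: finite_finset.
Qed.

Lemma finite_rv_pair (V W : finType) (X : T -> V) (Y : T -> W) :
  finite_rv X -> finite_rv Y -> finite_rv (fun w => (X w, Y w)).
Proof.
move=> mX mY; apply: finite_rv_singletons => -[a b].
rewrite (_ : _ @^-1` _ = X @^-1` [set a] `&` Y @^-1` [set b]).
  exact: measurableI.
by apply/seteqP; split=> w /= => [[<- <-]|[-> ->]].
Qed.

Lemma finite_rv_expectation (V : finType) (X : T -> V) (F : V -> R) :
    finite_rv X -> (forall v, 0 <= F v) ->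
  'E_P[fun w => F (X w)]%E = (\sum_v F v * prob P (X @^-1` [set v]))%:E.
Proof.
move=> mX F0; rewrite unlock.
(* A finite combination of indicators with nonnegative weights, which the integral can be exchanged
   with. *)
have FE w : (F (X w))%:E =
    (\sum_v (F v)%:E * (\1_(X @^-1` [set v]) w)%:E)%E.
  rewrite (bigD1 (X w))//= big1 => [|v vX].
    by rewrite indicE mem_set// mule1 adde0.
  by rewrite indicE memNset ?mule0//= => Xv; rewrite Xv eqxx in vX.
under eq_integral => w _ do rewrite FE.
rewrite ge0_integral_sum//=.
- rewrite -sumEFin; apply: eq_bigr => v _.
  rewrite EFinM probK// ge0_integralZl//=; last 2 first.
  + by apply/measurable_EFinP; exact: measurable_indic.
  + by rewrite lee_fin.
  by rewrite integral_indic// setIT.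
- move=> v; apply: emeasurable_funM => //.
  by apply/measurable_EFinP; exact: measurable_indic.
- by move=> v w _; rewrite mule_ge0 ?lee_fin.
Qed.

Lemma finite_rv_prob (V : finType) (X : T -> V) (Q : pred V) :
    finite_rv X ->
  prob P [set w | Q (X w)] = \sum_v (Q v)%:R * prob P (X @^-1` [set v]).
Proof.
move=> mX.
have mQ : measurable [set w | Q (X w)] by exact: (mX [set v | Q v]).
apply: EFin_inj; rewrite probK// -expectation_indic//.
rewrite -finite_rv_expectation//.
congr expectation; apply/funext => w; rewrite indicE.
by congr (_%:R); congr nat_of_bool; apply/idP/idP => [/set_mem|/mem_set].
Qed.

Lemma finite_rv_prob1 (V : finType) (X : T -> V) :
  finite_rv X -> \sum_v prob P (X @^-1` [set v]) = 1.
Proof.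
move=> mX; rewrite -probT.
have -> : setT = [set w | predT (X w)] :> set T by apply/seteqP.
by rewrite finite_rv_prob//; apply: eq_bigr => v _; rewrite mul1r.
Qed.

End FiniteRandomVariables.

(** * Laws of histories and contraction in mean *)

Section History.
Context {disp : measure_display} {T : measurableType disp} {R : realType}.
Variable P : probability T R.

(** Nested pairs with the latest draw outermost, so that one more iteration is one more pair and
    each length gives a finite type. *)
Fixpoint hist (O : finType) (k : nat) : finType :=
  if k is k'.+1 then (hist O k' * O)%type else unit.

Fixpoint past (O : finType) (D : nat -> T -> O) (k : nat) : T -> hist O k :=
  if k is k'.+1 then fun w => (past D k' w, D k' w) else fun=> tt.

Lemma finite_rv_past (O : finType) (D : nat -> T -> O) (k : nat) :
  (forall i, finite_rv (D i)) -> finite_rv (past D k).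
Proof.
move=> mD; elim: k => [|k IH]; last exact: finite_rv_pair.
apply: finite_rv_singletons => -[].
by rewrite (_ : _ @^-1` _ = setT)//; apply/seteqP.
Qed.

(** A history fixes the draws at the indices below [k]; independence over [k :: iota 0 k] then
    splits off the factor of draw [k]. *)
Lemma prob_past_draw (U V W : finType) (X : nat -> T -> U) (Y : nat -> T -> V)
    (Z : nat -> T -> W) (k : nat)
    (h : hist (U * V * W)%type k) (o : (U * V * W)%type) :
    independent_draws P X Y Z ->
  prob P (past (fun i w => (X i w, Y i w, Z i w)) k.+1 @^-1` [set (h, o)]) =
  prob P (past (fun i w => (X i w, Y i w, Z i w)) k @^-1` [set h]) *
  (prob P (X k @^-1` [set o.1.1]) * prob P (Y k @^-1` [set o.1.2])
   * prob P (Z k @^-1` [set o.2])).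
Proof.
move=> indep; set D := fun _ _ => _.
(* Puts the event of a history in the form that [independent_draws] speaks of; each new draw
   overwrites the constraint sets at its own index. *)
have pastE j (h' : hist (U * V * W)%type j) : exists A B C,
    past D j @^-1` [set h'] = [set w | forall i, i \in iota 0 j ->
      [/\ A i (X i w), B i (Y i w) & C i (Z i w)]].
  elim: j h' => [[]|j IH [h' [[a b] c]]].
    by exists (fun=> setT), (fun=> setT), (fun=> setT); apply/seteqP.
  have [A [B [C ABC]]] := IH h'.
  exists (fun i => if i == j then [set a] else A i),
    (fun i => if i == j then [set b] else B i),
    (fun i => if i == j then [set c] else C i).
  have iotaS i : (i \in iota 0 j.+1) = (i \in iota 0 j) || (i == j).
    by rewrite !mem_iota !add0n !leq0n ltnS leq_eqVlt orbC.
  have ltj i : i \in iota 0 j -> (i == j) = false.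
    by rewrite mem_iota add0n => /andP[_ ij]; rewrite ltn_eqF.
  apply/seteqP; split=> w.
    move=> [hw aw bw cw] i; rewrite iotaS.
    have : (past D j @^-1` [set h']) w by [].
    rewrite ABC => /= Hw /orP[ij|]; first by rewrite ltj//; exact: Hw.
    by move=> /eqP ->; rewrite eqxx.
  move=> /= Hw.
  have : (past D j @^-1` [set h']) w.
    rewrite ABC => i ij; have := Hw i; rewrite ltj//; apply.
    by rewrite iotaS ij.
  move=> /= ->; have := Hw j; rewrite eqxx iotaS eqxx orbT.
  by move=> /(_ isT) [/= <- <- <-].
have [A [B [C ABC]]] := pastE k h.
have ltk i : i \in iota 0 k -> (i == k) = false.
  by rewrite mem_iota add0n => /andP[_ ik]; rewrite ltn_eqF.
rewrite ABC indep ?iota_uniq// mulrC.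
set A' := fun i => if i == k then [set o.1.1] else A i.
set B' := fun i => if i == k then [set o.1.2] else B i.
set C' := fun i => if i == k then [set o.2] else C i.
have := indep (k :: iota 0 k) A' B' C'.
rewrite big_cons /= mem_iota add0n ltnn andbF iota_uniq => /(_ isT).
rewrite {2}/A' {2}/B' {2}/C' eqxx.
rewrite (eq_big_seq (fun i => prob P (X i @^-1` A i) * prob P (Y i @^-1` B i)
    * prob P (Z i @^-1` C i))) => [<-|i ik]; last by rewrite /A' /B' /C' ltk.
congr (prob P _); apply/seteqP; split=> w.
  move=> [hw ow] i; rewrite in_cons => /orP[/eqP ->|ik].
    by rewrite /A' /B' /C' eqxx -ow.
  rewrite /A' /B' /C' ltk//.
  have : (past D k @^-1` [set h]) w by [].
  by rewrite ABC; apply.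
move=> /= Hw.
have : (past D k @^-1` [set h]) w.
  rewrite ABC => i ik; have := Hw i; rewrite /A' /B' /C' ltk//; apply.
  by rewrite in_cons ik orbT.
move=> /= ->; have := Hw k; rewrite /A' /B' /C' eqxx in_cons eqxx /=.
move=> /(_ isT) [/= Xw Yw Zw]; congr pair.
by rewrite /D Xw Yw Zw; case: o {A' B' C' Hw Xw Yw Zw} => -[].
Qed.

(** The law of a longer history is a product, so the inner sum over the new draw is a conditional
    mean, bounded by [step]. Histories of probability 0 contribute nothing to either side. *)
Lemma expectation_contraction (O : finType) (D : nat -> T -> O) (mu : O -> R)
    (F : forall k, hist O k -> R) (c : R) (k : nat) :
    (forall k, finite_rv (D k)) ->
    (forall k (h : hist O k) o,
      prob P (past D k.+1 @^-1` [set (h, o)]) =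
      prob P (past D k @^-1` [set h]) * mu o) ->
    (forall k h, 0 <= F k h) -> 0 <= c ->
    (forall k (h : hist O k), prob P (past D k @^-1` [set h]) != 0 ->
      \sum_o mu o * F k.+1 (h, o) <= c * F k h) ->
  ('E_P[fun w => F k (past D k w)] <= (c ^+ k * F 0 tt)%:E)%E.
Proof.
move=> mD PD F0 c0 step.
rewrite (finite_rv_expectation _ (F := F k) (finite_rv_past mD))// lee_fin.
elim: k => [|k IH].
  rewrite expr0 mul1r (bigD1 tt)//= big1 ?addr0 => [|[]]//.
  rewrite (_ : _ @^-1` _ = setT) ?probT ?mulr1//.
  by apply/seteqP; split=> // w _ /=; case: (past _ _ _).
rewrite exprS -mulrA; apply: le_trans (ler_wpM2l c0 IH).
rewrite [leLHS](_ : _ = \sum_(h : hist O k) \sum_(o : O)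
    F k.+1 (h, o) * prob P (past D k.+1 @^-1` [set (h, o)])); last first.
  by rewrite pair_bigA; apply: eq_bigr => -[].
rewrite mulr_sumr; apply: ler_sum => h _.
under eq_bigr do rewrite PD mulrCA (mulrC (F _ _)).
rewrite -mulr_sumr mulrA (mulrC (c * _)).
have [->|Ph] := eqVneq (prob P (past D k @^-1` [set h])) 0.
  by rewrite !mul0r.
by rewrite ler_wpM2l ?prob_ge0// step.
Qed.

End History.

(** * One step of SVRCDG *)

Section Estimator.
Context {R : realType}.

(* [(s + t)^2 <= 2 s^2 + 2 t^2], then the variance of B is at most its second
   moment. *)
Lemma shifted_second_moment (O : finType) (mu A B : O -> R) (e c a b : R) :
    (forall o, 0 <= mu o) -> \sum_o mu o = 1 ->
    \sum_o mu o * A o = a -> \sum_o mu o * B o = b ->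
  \sum_o mu o * (e - c * (A o - (B o - b))) ^+ 2
  <= e ^+ 2 - 2 * c * e * a
     + 2 * c ^+ 2 * (\sum_o mu o * A o ^+ 2 + \sum_o mu o * B o ^+ 2).
Proof.
move=> mu0 mu1 EA EB.
(* The part free of [A o] and [B o]. After averaging, the terms in [b] add up to [- 2 (c b)^2],
   which is dropped. *)
pose k := e ^+ 2 - 2 * c * e * b + 2 * c ^+ 2 * b ^+ 2.
have H o : mu o * (e - c * (A o - (B o - b))) ^+ 2 <=
    mu o * k - 2 * c * e * (mu o * A o)
    + (2 * c * e - 4 * c ^+ 2 * b) * (mu o * B o)
    + 2 * c ^+ 2 * (mu o * A o ^+ 2 + mu o * B o ^+ 2).
  rewrite -subr_ge0 (_ : _ - _ = mu o * (c * (A o + B o - b)) ^+ 2).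
    by rewrite mulr_ge0// sqr_ge0.
  by rewrite /k; ring.
apply: le_trans (ler_sum _ (fun o _ => H o)) _.
rewrite !big_split/= sumrN -!mulr_sumr -mulr_suml big_split/= EA EB mu1 /k.
have := sqr_ge0 (c * b); rewrite exprMn; lra.
Qed.

Lemma sum_triple (U V W : finType) (a : U -> R) (b : V -> R) (c : W -> R) :
  \sum_(o : U * V * W) a o.1.1 * b o.1.2 * c o.2 =
  (\sum_u a u) * (\sum_v b v) * (\sum_w c w).
Proof.
transitivity (\sum_u \sum_v \sum_w a u * b v * c w).
  by rewrite pair_bigA pair_bigA.
rewrite -mulrA big_distrl; apply: eq_bigr => u _.
rewrite big_distrl big_distrr; apply: eq_bigr => v _.
by rewrite /= mulrA big_distrr.
Qed.

Lemma invmx_diag_of (n : nat) (v : 'I_n -> R) :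
  (forall j, v j != 0) -> invmx (diag_of v) = diag_of (fun j => (v j)^-1).
Proof.
move=> v0; have vV : diag_of (fun j => (v j)^-1) *m diag_of v = 1%:M.
  apply/matrixP => i j; rewrite mul_diag_mx !mxE.
  by have [->|_] := eqVneq i j; rewrite ?mulr0n ?mulr0// !mulr1n mulVf.
by rewrite -[LHS]mul1mx -vV mulmxK//; case/mulmx1_unit: vV.
Qed.

(** The Loewner inequality is tested on [c]. Since [PS j j'] is the mean of a product of two
    indicators, the quadratic form on the left is the second moment of the sampled sum. *)
Lemma ESO_sum (n : nat) (muS : {set 'I_n} -> R) (r q : 'I_n -> R)
    (PS : 'M[R]_n) (c : 'I_n -> R) :
    (forall j j', PS j j' =
      \sum_(s : {set 'I_n}) ((j \in s) && (j' \in s))%:R * muS s) ->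
    (forall j, 0 < r j) -> (forall j, 0 < q j) ->
    loewner_le (invmx (diag_of r) *m PS *m invmx (diag_of r))
      (invmx (diag_of q)) ->
  \sum_(s : {set 'I_n}) muS s * (\sum_j (j \in s)%:R / r j * c j) ^+ 2
  <= \sum_j c j ^+ 2 / q j.
Proof.
move=> PSE r0 q0; rewrite !invmx_diag_of; last 2 first.
- by move=> j; rewrite gt_eqF.
- by move=> j; rewrite gt_eqF.
move=> /(_ (\row_j c j)); rewrite mulmxBr mulmxBl [X in 0 <= X]mxE.
rewrite [X in _ + X]mxE subr_ge0.
set A := (X in X <= _); set B := (X in _ <= X).
have -> : A =
    \sum_(s : {set 'I_n}) muS s * (\sum_j (j \in s)%:R / r j * c j) ^+ 2.
  rewrite /A !mulmxA mxE.
  transitivity (\sum_j' \sum_j \sum_s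
      muS s * (((j \in s)%:R / r j * c j) * ((j' \in s)%:R / r j' * c j'))).
    apply: eq_bigr => j' _; rewrite mul_mx_diag !mxE !mulr_suml.
    apply: eq_bigr => j _; rewrite mul_mx_diag !mxE PSE mulr_sumr !mulr_suml.
    by apply: eq_bigr => s _; rewrite -mulnb natrM; ring.
  rewrite (eq_bigr _ (fun _ _ => exchange_big _ _ _ _ _ _))/= exchange_big/=.
  apply: eq_bigr => s _; rewrite expr2 mulr_sumr mulr_sumr.
  apply: eq_bigr => j' _; by rewrite mulr_suml mulr_sumr.
suff -> : B = \sum_j c j ^+ 2 / q j by [].
rewrite /B mxE; apply: eq_bigr => j _; rewrite mul_mx_diag !mxE.
by ring.
Qed.

End Estimator.

(** * Contraction of the Lyapunov function under a finite law of draws *)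

Section OneStep.
Context {R : realType} {d n : nat}.
Variables (f : 'I_n -> 'rV[R]_d -> R) (psi : 'rV[R]_d -> \bar R).
Variables (xstar : 'rV[R]_d) (sigma rho alpha : R) (m : 'I_n -> 'I_d -> R).
Variables (muL : {set 'I_d} -> R) (muS : {set 'I_n} -> R) (muC : bool -> R).
Variables (p : 'I_d -> R) (r q : 'I_n -> R).
Hypothesis n_gt0 : (0 < n)%N.
Hypothesis f_diff : forall j x, differentiable (f j) x.
Hypothesis f_convex : forall j, convex_function setT (f j).
Hypothesis psi_proper : proper_fun psi.
Hypothesis psi_convex : convex_fun psi.
Hypothesis xstar_min : argmin (fun x => (average f x)%:E + psi x)%E xstar.
Hypothesis f_qsc : quasi_strongly_convex sigma (average f) xstar.
Hypothesis m_ge0 : forall i j, 0 <= m j i.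
Hypothesis f_smooth : forall j, diag_smooth (m j) (f j).
Hypothesis muL_ge0 : forall l, 0 <= muL l.
Hypothesis muS_ge0 : forall s, 0 <= muS s.
Hypothesis muL_sum : \sum_(l : {set 'I_d}) muL l = 1.
Hypothesis muS_sum : \sum_(s : {set 'I_n}) muS s = 1.
Hypothesis muCE : forall b, muC b = if b then rho else 1 - rho.
Hypothesis pE : forall i, p i = \sum_(l : {set 'I_d}) (i \in l)%:R * muL l.
Hypothesis rE : forall j, r j = \sum_(s : {set 'I_n}) (j \in s)%:R * muS s.
Hypothesis p_gt0 : forall i, 0 < p i.
Hypothesis r_gt0 : forall j, 0 < r j.
Hypothesis q_gt0 : forall j, 0 < q j.
Hypothesis ESO : forall c : 'I_n -> R,
  \sum_(s : {set 'I_n}) muS s * (\sum_j (j \in s)%:R / r j * c j) ^+ 2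
  <= \sum_j c j ^+ 2 / q j.
Hypothesis sigma_gt0 : 0 < sigma.
Hypothesis rho_gt0 : 0 < rho.
Hypothesis rho_le1 : rho <= 1.
Hypothesis alpha_gt0 : 0 < alpha.
Hypothesis alpha_le : forall i j,
  4 * alpha * (m j i / (p i * q j * n%:R)) <= 1 - alpha * sigma / rho.

Let mu (o : {set 'I_d} * {set 'I_n} * bool) : R :=
  muL o.1.1 * muS o.1.2 * muC o.2.

(** Unbiased estimator of [\sum_j c j] in coordinate [i], reweighted by the inclusion
    probabilities. *)
Let U (i : 'I_d) (c : 'I_n -> R) (o : {set 'I_d} * {set 'I_n} * bool) : R :=
  (i \in o.1.1)%:R / p i * \sum_j (j \in o.1.2)%:R / r j * c j.

Let n_gt0R : 0 < n%:R :> R. Proof. by rewrite ltr0n. Qed.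

Let muC_ge0 b : 0 <= muC b.
Proof. by rewrite muCE; case: b; [exact: ltW | rewrite subr_ge0]. Qed.

Let muC_sum : \sum_b muC b = 1.
Proof. by rewrite big_bool !muCE/= addrC subrK. Qed.

Let mu_ge0 o : 0 <= mu o.
Proof. by rewrite !mulr_ge0. Qed.

Let mu_sum : \sum_o mu o = 1.
Proof. by rewrite sum_triple muL_sum muS_sum muC_sum !mulr1. Qed.

Lemma mean_U i c : \sum_o mu o * U i c o = \sum_j c j.
Proof.
transitivity ((\sum_(l : {set 'I_d}) muL l * ((i \in l)%:R / p i)) *
    (\sum_(s : {set 'I_n}) muS s * (\sum_j (j \in s)%:R / r j * c j)) *
    \sum_b muC b).
  by rewrite -sum_triple; apply: eq_bigr => o _; rewrite /mu /U; ring.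
rewrite muC_sum mulr1.
have -> : \sum_(l : {set 'I_d}) muL l * ((i \in l)%:R / p i) = 1.
  under eq_bigr do rewrite mulrA (mulrC (muL _)).
  by rewrite -mulr_suml -pE divff ?gt_eqF.
under eq_bigr do rewrite mulr_sumr.
rewrite mul1r exchange_big/=; apply: eq_bigr => j _.
rewrite (eq_bigr (fun s : {set 'I_n} => (j \in s)%:R * muS s * (c j / r j)));
  last by move=> s _; ring.
by rewrite -mulr_suml -rE mulrC divfK ?gt_eqF.
Qed.

(** The product law separates the two samplings: an indicator equals its square, so the coordinate
    factor is [1 / p i], and [ESO] bounds the other factor. *)
Lemma second_moment_U i c :
  \sum_o mu o * U i c o ^+ 2 <= \sum_j c j ^+ 2 / (p i * q j).
Proof.
rewrite [leLHS](_ : _ =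
    (\sum_(l : {set 'I_d}) muL l * ((i \in l)%:R / p i ^+ 2)) *
    (\sum_(s : {set 'I_n}) muS s * (\sum_j (j \in s)%:R / r j * c j) ^+ 2) *
    \sum_b muC b); last first.
  rewrite -sum_triple; apply: eq_bigr => o _; rewrite /mu /U.
  by case: (i \in _); rewrite /= ?mulr1n ?mulr0n; field; rewrite gt_eqF.
rewrite muC_sum mulr1.
have -> : \sum_(l : {set 'I_d}) muL l * ((i \in l)%:R / p i ^+ 2) = (p i)^-1.
  under eq_bigr do rewrite mulrA (mulrC (muL _)).
  by rewrite -mulr_suml -pE; field; rewrite gt_eqF.
rewrite [leRHS](_ : _ = (p i)^-1 * \sum_j c j ^+ 2 / q j).
  by rewrite ler_wpM2l// invr_ge0 ltW.
by rewrite mulr_sumr; apply: eq_bigr => j _; field; rewrite !gt_eqF.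
Qed.

Let h : 'rV[R]_d := grad (average f) xstar.

Let hE i : h 0 i = n%:R^-1 * \sum_j partial i (f j) xstar.
Proof. by rewrite mxE partial_average. Qed.

Lemma dot_grad_average u :
  dot h u = n%:R^-1 * \sum_j dot (grad (f j) xstar) u.
Proof.
rewrite /dot; under eq_bigr do rewrite hE -mulrA mulr_suml.
rewrite -mulr_sumr exchange_big; congr (_ * _).
by apply: eq_bigr => j _; apply: eq_bigr => i _; rewrite [grad _ _ _ _]mxE.
Qed.

(** The quadratic model along segments from [xstar] that [argmin_smooth_subgrad] asks for. *)
Lemma average_smooth_ub u (t : R) :
  average f (t *: u + (1 - t) *: xstar) <=
  average f xstar + t * dot h (u - xstar)
  + t ^+ 2 * (n%:R^-1 * \sum_j 2^-1 * \sum_i m j i * (u 0 i - xstar 0 i) ^+ 2).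
Proof.
rewrite dot_grad_average /average mulrCA (mulrCA (t ^+ 2)) -!mulrDr.
rewrite ler_pM2l ?invr_gt0//.
rewrite !mulr_sumr -!big_split/=; apply: ler_sum => j _.
apply: le_trans (f_smooth j _ xstar) _.
rewrite (_ : _ - xstar = t *: (u - xstar)); last first.
  by apply/rowP => i; rewrite !mxE; ring.
rewrite dotZr lerD2l mulrCA ler_pM2l// mulr_sumr le_eqVlt; apply/orP; left.
by apply/eqP; apply: eq_bigr => i _; rewrite !mxE; ring.
Qed.

Lemma xstar_subgrad :
  psi xstar \is a fin_num /\
  forall u, psi u \is a fin_num ->
    0 <= fine (psi u) - fine (psi xstar) + dot h (u - xstar).
Proof.
have [|fx H] := @argmin_smooth_subgrad _ _ (average f) psi xstar h _ 1
  psi_proper psi_convex ltr01 (fun u t _ => average_smooth_ub u t).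
  by move=> u; rewrite !mul1e addeC (addeC (psi u)).
by split=> // u fu; have := H u fu; rewrite mul1r.
Qed.

Section Step.
Variables (x : 'rV[R]_d) (J : 'M[R]_(d, n)).
Variable y : {set 'I_d} * {set 'I_n} * bool -> 'rV[R]_d.
Hypothesis J_range : in_range m (J - Jac f xstar).
(** Restricted to draws of nonzero weight, because [y] may hold a default value elsewhere. *)
Hypothesis y_prox : forall o, mu o != 0 ->
  prox alpha psi
    (x - alpha *: grad_estimator f p r x J o.1.1 o.1.2) (y o).

Let e i := x 0 i - xstar 0 i.
Let X i j := partial i (f j) x - partial i (f j) xstar.
Let W i j := J i j - partial i (f j) xstar.
Let YX := \sum_i \sum_j (m j i)^-1 * X i j ^+ 2.
Let YW := \sum_i \sum_j (m j i)^-1 * W i j ^+ 2.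

(** Writing [partial i (f j) x - J i j] as [X i j - W i j] brings the residual to the form of
    [shifted_second_moment], with [\sum_j W i j] as the mean of the second estimator. *)
Lemma estimator_residual o i :
  (x - alpha *: grad_estimator f p r x J o.1.1 o.1.2
   - (xstar - alpha *: h)) 0 i =
  e i - alpha / n%:R * (U i (X i) o - (U i (W i) o - \sum_j W i j)).
Proof.
rewrite !mxE partial_average//.
have -> : U i (X i) o - (U i (W i) o - \sum_j W i j) =
    \sum_(j in o.1.2)
      (i \in o.1.1)%:R / (p i * r j) * (partial i (f j) x - J i j)
    + (\sum_j J i j - \sum_j partial i (f j) xstar).
  rewrite -sumrB opprB addrCA addrC; congr (_ + _); rewrite /U -mulrBr -sumrB.
  rewrite [RHS]big_mkcond mulr_sumr; apply: eq_bigr => j _ /=.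
  case: (j \in _); last by rewrite /= mulr0n; ring.
  by rewrite /X /W mulr1n; field; rewrite !gt_eqF.
by rewrite /e; ring.
Qed.

Lemma mean_sqnorm_residual :
  \sum_o mu o * sqnorm (y o - xstar) <=
  sqnorm (x - xstar) - 2 * alpha * dot (grad (average f) x - h) (x - xstar)
  + 2 * (alpha / n%:R) ^+ 2 *
    \sum_i \sum_j (X i j ^+ 2 + W i j ^+ 2) / (p i * q j).
Proof.
have [fxs sub] := xstar_subgrad.
apply: (@le_trans _ _ (\sum_o mu o * sqnorm
  (x - alpha *: grad_estimator f p r x J o.1.1 o.1.2
   - (xstar - alpha *: h)))).
  apply: ler_sum => o _.
  have [->|mo] := eqVneq (mu o) 0; first by rewrite !mul0r.
  rewrite ler_wpM2l//; have yp := y_prox mo.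
  exact: (prox_nonexpansive psi_proper psi_convex alpha_gt0 yp fxs sub).
under eq_bigr do rewrite sqnorm_sumsq mulr_sumr.
rewrite exchange_big sqnorm_sumsq /dot mulr_sumr mulr_sumr -sumrB -big_split/=.
apply: ler_sum => i _; under eq_bigr do rewrite estimator_residual.
have := shifted_second_moment (e i) (alpha / n%:R) mu_ge0 mu_sum
  (mean_U i (X i)) (mean_U i (W i)).
move=> /le_trans; apply.
have := second_moment_U i (X i); have := second_moment_U i (W i).
have -> : (grad (average f) x - h) 0 i = n%:R^-1 * \sum_j X i j.
  by rewrite !mxE !partial_average// -mulrBr -sumrB.
have -> : (x - xstar) 0 i = e i by rewrite !mxE.
have -> : \sum_j (X i j ^+ 2 + W i j ^+ 2) / (p i * q j) =
    \sum_j X i j ^+ 2 / (p i * q j) + \sum_j W i j ^+ 2 / (p i * q j).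
  by rewrite -big_split; apply: eq_bigr => j _; rewrite mulrDl.
set sW := \sum_o _ * _ ^+ 2; set sX := \sum_o _ * _ ^+ 2 => leW leX.
rewrite (_ : 2 * (alpha / _) * _ * _ =
  2 * alpha * (n%:R^-1 * (\sum_j X i j) * e i)); last by ring.
by rewrite lerD2l ler_wpM2l ?lerD// mulr_ge0// sqr_ge0.
Qed.

(** Cocoercivity of each [f j] bounds the Bregman divergence from [xstar] to [x] below; quasi strong
    convexity at [x] supplies the other term, and the function values cancel in the sum. *)
Lemma bregman_average_ge :
  (2 * n%:R)^-1 * YX + sigma / 2 * sqnorm (x - xstar)
  <= dot (grad (average f) x - h) (x - xstar).
Proof.
have := f_qsc x; rewrite -opprB dotNr.
have : (2 * n%:R)^-1 * YX <=
    average f x - average f xstar - dot h (x - xstar).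
  rewrite dot_grad_average /average -!mulrBr -!sumrB invfM mulrAC mulrC.
  rewrite ler_pM2l ?invr_gt0//.
  rewrite /YX exchange_big mulr_sumr; apply: ler_sum => j _.
  exact: bregman_ge_cocoercive.
by rewrite dotDl dotNl; lra.
Qed.

Lemma sampled_weight_le (A : 'I_d -> 'I_n -> R) :
    (forall i j, m j i = 0 -> A i j = 0) ->
  2 * (alpha / n%:R) ^+ 2 * \sum_i \sum_j A i j ^+ 2 / (p i * q j) <=
  alpha * (1 - alpha * sigma / rho) / (2 * n%:R) *
    \sum_i \sum_j (m j i)^-1 * A i j ^+ 2.
Proof.
move=> A0; rewrite !mulr_sumr; apply: ler_sum => i _.
rewrite !mulr_sumr; apply: ler_sum => j _.
have [mj0|mj] := eqVneq (m j i) 0.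
  by rewrite A0// mj0 expr0n /= mul0r !mulr0.
have mp : 0 < m j i by rewrite lt_neqAle eq_sym mj m_ge0.
have nz : [&& m j i != 0, p i != 0, q j != 0 & n%:R != 0 :> R].
  by rewrite mj !gt_eqF.
have := alpha_le i j.
set c := 1 - _ => ac.
(* Isolates exactly the quantity that [alpha_le] bounds by [c]. *)
rewrite (_ : _ * (_ / _) = alpha * (2 * n%:R)^-1 * (m j i)^-1 * A i j ^+ 2 *
    (4 * alpha * (m j i / (p i * q j * n%:R)))); last first.
  by case/and4P: nz => *; field; do ?[apply/andP; split].
rewrite (_ : alpha * c / _ * _ =
  alpha * (2 * n%:R)^-1 * (m j i)^-1 * A i j ^+ 2 * c); last by ring.
rewrite ler_wpM2l// mulr_ge0 ?sqr_ge0// mulr_ge0 ?invr_ge0 ?m_ge0//.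
by rewrite mulr_ge0 ?invr_ge0 ?mulr_ge0 ?ler0n ?(ltW alpha_gt0).
Qed.

(* This beta makes alpha * beta^2 * rho = alpha / (2 n): refreshing the Jacobian
   costs half of the Bregman gain (alpha / n) YX, and the stepsize leaves the
   other half for the variance of the estimator. *)
Lemma lyapunov_contraction (beta : R) :
    beta ^+ 2 = (2 * n%:R * rho)^-1 ->
  \sum_o mu o * lyapunov f m xstar alpha beta (y o)
    (if o.2 then Jac f x else J)
  <= (1 - alpha * sigma) * lyapunov f m xstar alpha beta x J.
Proof.
move=> bE.
(* The coin alone decides the new Jacobian estimate, so the two samplings sum out to 1. *)
have YE : \sum_o mu o * (\sum_i \sum_j (m j i)^-1 *
    ((if o.2 then Jac f x else J) i j - partial i (f j) xstar) ^+ 2)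
    = rho * YX + (1 - rho) * YW.
  pose g (b : bool) := muC b * if b then YX else YW.
  rewrite (eq_bigr (fun o : {set 'I_d} * {set 'I_n} * bool =>
      muL o.1.1 * muS o.1.2 * g o.2)) => [|o _].
    rewrite (sum_triple muL muS g) muL_sum muS_sum !mul1r.
    by rewrite big_bool /g/= !muCE.
  rewrite /mu -mulrA; congr (_ * (_ * _)).
  rewrite /YX /YW; case: o.2 => //.
  by apply: eq_bigr => i _; apply: eq_bigr => j _; rewrite mxE.
rewrite /lyapunov bE; under eq_bigr do rewrite mulrDr (mulrCA (mu _)).
rewrite big_split/= -mulr_sumr YE.
have := mean_sqnorm_residual; have := bregman_average_ge.
have X0 i j : m j i = 0 -> X i j = 0.
  move=> mj; apply/eqP; rewrite subr_eq0; apply/eqP.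
  exact: (grad_eq_of_m0 x (f_diff j xstar) (f_convex j) (f_smooth j)).
have W0 i j : m j i = 0 -> W i j = 0.
  by move=> mj; have := J_range mj; rewrite !mxE.
have := sampled_weight_le X0; have := sampled_weight_le W0.
rewrite -/YX -/YW => hW hX hD.
have YX0 : 0 <= YX.
  by do 2!apply: sumr_ge0 => ? _; rewrite mulr_ge0 ?sqr_ge0 ?invr_ge0.
rewrite (_ : \sum_i \sum_j _ = \sum_i \sum_j X i j ^+ 2 / (p i * q j)
    + \sum_i \sum_j W i j ^+ 2 / (p i * q j)); last first.
  rewrite -big_split; apply: eq_bigr => i _; rewrite -big_split.
  by apply: eq_bigr => j _; rewrite mulrDl.
move: hW hX hD; set k := 2 * (_ / _) ^+ 2.
set AX := \sum_i \sum_j X i j ^+ 2 / _; set AW := \sum_i \sum_j W i j ^+ 2 / _.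
set E := sqnorm (x - _); set Dt := dot _ _ => hW hX hD hN.
have hD' : 2 * alpha * ((2 * n%:R)^-1 * YX + sigma / 2 * E) <= 2 * alpha * Dt.
  by rewrite ler_wpM2l// mulr_ge0// ltW.
have nn : n%:R != 0 :> R by rewrite gt_eqF.
have rn : rho != 0 by rewrite gt_eqF.
have hY : 0 <= alpha / (2 * n%:R) * (alpha * sigma / rho) * YX.
  apply: mulr_ge0 YX0; apply/ltW/mulr_gt0.
    by rewrite divr_gt0 ?mulr_gt0.
  by rewrite divr_gt0 ?mulr_gt0.
rewrite -subr_ge0 in hN; rewrite -subr_ge0 in hD'.
rewrite -subr_ge0 in hX; rewrite -subr_ge0 in hW.
rewrite -subr_ge0; set goal := (X in 0 <= X).
(* The gap is the sum of the slacks of the four inequalities above and of the surplus [hY] left by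
   the stepsize. *)
suff -> : goal =
  (E - 2 * alpha * Dt + k * (AX + AW) - \sum_i mu i * sqnorm (y i - xstar))
  + (2 * alpha * Dt - 2 * alpha * ((2 * n%:R)^-1 * YX + sigma / 2 * E))
  + (alpha * (1 - alpha * sigma / rho) / (2 * n%:R) * YX - k * AX)
  + (alpha * (1 - alpha * sigma / rho) / (2 * n%:R) * YW - k * AW)
  + (alpha / (2 * n%:R) * (alpha * sigma / rho) * YX).
  by do 4![apply: addr_ge0 => //].
rewrite /goal -/YW; field.
by rewrite nn rn.
Qed.

End Step.

End OneStep.

(** * Iteration complexity *)

Section DeterministicState.
Context {R : realType} {d n : nat}.
Variables (f : 'I_n -> 'rV[R]_d -> R) (psi : 'rV[R]_d -> \bar R).
Variables (alpha : R) (p : 'I_d -> R) (r : 'I_n -> R) (x0 : 'rV[R]_d).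

(* [xget] returns the junk value 0 when there is no proximal point; this happens
   only on histories of probability 0, so existence is never needed. *)
Fixpoint svrcdg_state (k : nat) :
    hist ({set 'I_d} * {set 'I_n} * bool)%type k -> 'rV[R]_d * 'M[R]_(d, n) :=
  if k is k'.+1 then fun h =>
    let: (x, J) := svrcdg_state h.1 in
    (xget 0 (prox alpha psi
       (x - alpha *: grad_estimator f p r x J h.2.1.1 h.2.1.2)),
     if h.2.2 then Jac f x else J)
  else fun=> (x0, 0).

(** The estimate is either still 0 or a Jacobian at some point, and by [grad_eq_of_m0] the entries
    with [m j i = 0] agree in all Jacobians. *)
Lemma svrcdg_state_range (m : 'I_n -> 'I_d -> R) (xstar : 'rV[R]_d) k
    (h : hist ({set 'I_d} * {set 'I_n} * bool)%type k) :
    (forall j x, differentiable (f j) x) ->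
    (forall j, convex_function setT (f j)) ->
    (forall j, diag_smooth (m j) (f j)) ->
    in_range m (0 - Jac f xstar) ->
  in_range m ((svrcdg_state h).2 - Jac f xstar).
Proof.
move=> df cf sf R0; elim: k h => [|k IH] //= -[h [[l s] b]] /=.
have := IH h; case: (svrcdg_state h) => x J /=; case: b => //= _ i j mj.
by rewrite !mxE (grad_eq_of_m0 x (df j xstar) (cf j) (sf j) mj) subrr.
Qed.

End DeterministicState.

(** Uniqueness of proximal points makes the iterates functions of the draws made so far, which
    reduces expectations to sums over histories. *)
Lemma svrcdg_stateE (disp : measure_display) (T : measurableType disp)
    (R : realType) (P : probability T R) (d n : nat)
    (f : 'I_n -> 'rV[R]_d -> R) psi (alpha rho : R) L S (x0 : 'rV[R]_d)
    Lk Sk Ck x J k w :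
    proper_fun psi -> convex_fun psi -> 0 < alpha ->
    svrcdg P f psi alpha rho L S x0 Lk Sk Ck x J ->
  svrcdg_state f psi alpha (incl_prob P L) (incl_prob P S) x0
    (past (fun i w => (Lk i w, Sk i w, Ck i w)) k w) = (x k w, J k w).
Proof.
move=> pp cp a0 A; elim: k => [|k IH] /=.
  by rewrite (svrcdg_x0 A) (svrcdg_J0 A).
rewrite IH /= -(svrcdg_J A); congr pair.
have px := svrcdg_x A k w.
apply: (prox_uniq pp cp a0 _ px).
by apply: xgetPex; exists (x k.+1 w).
Qed.

(** From [1 - a <= expR (- a)]; the bound [a <= 1] keeps the base nonnegative when taking powers. *)
Lemma pow_le_of_ln_le (R : realType) (a eps : R) (k : nat) :
  a <= 1 -> 0 < eps -> ln (1 / eps) <= a * k%:R -> (1 - a) ^+ k <= eps.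
Proof.
move=> a1 e0; rewrite div1r lnV ?posrE// => lek.
rewrite -[leRHS]lnK ?posrE//.
apply: (@le_trans _ _ (expR (- a) ^+ k)).
  by rewrite lerXn2r ?nnegrE ?subr_ge0 ?expR_ge0// expR_ge1Dx.
by rewrite -expRM_natl ler_expR; lra.
Qed.

Theorem corollaryM2
  (R : realType) (d' n' : nat) (d := d'.+1) (n := n'.+1)
  (disp : measure_display) (T : measurableType disp) (P : probability T R)
  (f : 'I_n -> 'rV[R]_d -> R) (psi : 'rV[R]_d -> \bar R)
  (xstar : 'rV[R]_d) (sigma : R) (m : 'I_n -> 'I_d -> R)
  (f_diff : forall j x, differentiable (f j) x)
  (f_convex : forall j, convex_function setT (f j))
  (psi_proper : proper_fun psi)
  (psi_closed : closed_fun psi)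
  (psi_convex : convex_fun psi)
  (xstar_min : argmin (fun x => (average f x)%:E + psi x)%E = [set xstar])
  (sigma_gt0 : 0 < sigma)
  (f_qsc : quasi_strongly_convex sigma (average f) xstar)
  (m_ge0 : forall i j, 0 <= m j i)
  (f_smooth : forall j, diag_smooth (m j) (f j))
  (J0_range : in_range m (0 - Jac f xstar))
  (L : T -> {set 'I_d}) (S : T -> {set 'I_n})
  (L_rv : finite_rv L) (S_rv : finite_rv S)
  (LS_indep : independent_rv P L S)
  (p := incl_prob P L) (r := incl_prob P S)
  (p_gt0 : forall i, 0 < p i) (r_gt0 : forall j, 0 < r j)
  (rho : R) (rho_gt0 : 0 < rho) (rho_le1 : rho <= 1)
  (q : 'I_n -> R) (q_gt0 : forall j, 0 < q j)
  (q_ESO : loewner_le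
             (invmx (diag_of r) *m prob_matrix P S *m invmx (diag_of r))
             (invmx (diag_of q)))
  (alpha := min2 (fun i j =>
     1 / (4 * (m j i / (p i * q j * n%:R)) + 1 / rho * sigma))) :
  exists beta : R, 0 < beta /\
    forall (x0 : 'rV[R]_d)
      (Lk : nat -> T -> {set 'I_d}) (Sk : nat -> T -> {set 'I_n})
      (Ck : nat -> T -> bool)
      (x : nat -> T -> 'rV[R]_d) (J : nat -> T -> 'M[R]_(d, n)),
    svrcdg P f psi alpha rho L S x0 Lk Sk Ck x J ->
    forall (eps : R) (k : nat),
      0 < eps < 1 ->
      max2 (fun i j => 4 * (m j i / (sigma * n%:R * p i * q j)) + 1 / rho)
        * ln (1 / eps) <= k%:R ->
      ('E_P[fun w => lyapunov f m xstar alpha beta (x k w) (J k w)]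
       <= (eps * lyapunov f m xstar alpha beta x0 0)%:E)%E.
Proof.
have n0 : 0 < n%:R :> R by rewrite ltr0n.
pose den i j := 4 * (m j i / (p i * q j * n%:R)) + 1 / rho * sigma.
have den0 i j : 0 < den i j.
  rewrite ltr_wpDl//; last by rewrite mulr_gt0 ?divr_gt0.
  by rewrite mulr_ge0// divr_ge0// !mulr_ge0// ltW.
have alpha_gt0 : 0 < alpha.
  by apply: lt_bigmin => [|ij _]; rewrite divr_gt0// den0.
have alpha_den i j : alpha * den i j <= 1.
  rewrite -ler_pdivlMr ?den0//.
  exact: (bigmin_le _ (i, j) (fun ij => 1 / den ij.1 ij.2)).
have alpha_le i j :
    4 * alpha * (m j i / (p i * q j * n%:R)) <= 1 - alpha * sigma / rho.
  have := alpha_den i j; rewrite /den.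
  set t := m j i / _.
  by rewrite (_ : alpha * sigma / rho = alpha * (1 / rho * sigma)); [lra|ring].
(* The left side of [alpha_le] is nonnegative, hence so is [1 - alpha sigma / rho]. *)
have as_le_rho : alpha * sigma <= rho.
  rewrite -[leRHS]mul1r -ler_pdivrMr// -subr_ge0.
  apply: le_trans (alpha_le ord0 ord0).
  by rewrite !mulr_ge0 ?invr_ge0 ?mulr_ge0// ltW.
have as_le1 : alpha * sigma <= 1 by exact: le_trans rho_le1.
exists (Num.sqrt (2 * n%:R * rho)^-1); split.
  by rewrite sqrtr_gt0 invr_gt0 !mulr_gt0.
set beta := Num.sqrt _.
have betaE : beta ^+ 2 = (2 * n%:R * rho)^-1.
  by rewrite sqr_sqrtr// invr_ge0 ltW// !mulr_gt0.
move=> x0 Lk Sk Ck x J A eps k /andP[eps0 eps1] kge.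
set D := fun i w => (Lk i w, Sk i w, Ck i w).
pose state := @svrcdg_state R d n f psi alpha p r x0.
pose F j h := lyapunov f m xstar alpha beta (state j h).1 (state j h).2.
have stateE j w : state j (past D j w) = (x j w, J j w).
  exact: (svrcdg_stateE _ _ psi_proper psi_convex alpha_gt0 A).
rewrite (_ : (fun w => _) = fun w => F k (past D k w)); last first.
  by apply/funext => w; rewrite /F stateE.
pose muC (b : bool) := if b then rho else 1 - rho.
pose mu (o : {set 'I_d} * {set 'I_n} * bool) :=
  prob P (L @^-1` [set o.1.1]) * prob P (S @^-1` [set o.1.2]) * muC o.2.
have mD i : finite_rv (D i).
  apply: finite_rv_pair (svrcdg_Ck_rv A i).
  exact: finite_rv_pair (svrcdg_Lk_rv A i) (svrcdg_Sk_rv A i).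
have coin i b : prob P (Ck i @^-1` [set b]) = muC b.
  have CT : Ck i @^-1` [set true] = [set w | Ck i w] by [].
  have mC : measurable [set w | Ck i w] by rewrite -CT; exact: (svrcdg_Ck_rv A).
  case: b; first by rewrite CT (svrcdg_Ck_law A).
  rewrite (_ : _ @^-1` _ = ~` (Ck i @^-1` [set true])).
    by rewrite probC ?CT ?(svrcdg_Ck_law A)//; exact: mC.
  by apply/seteqP; split=> w /=; case: (Ck i w).
have PD j h o : prob P (past D j.+1 @^-1` [set (h, o)]) =
    prob P (past D j @^-1` [set h]) * mu o.
  rewrite (prob_past_draw _ _ (svrcdg_indep A)) (svrcdg_Lk_law A).
  by rewrite (svrcdg_Sk_law A) coin.
have pE i : p i = \sum_(l : {set 'I_d}) (i \in l)%:R * prob P (L @^-1` [set l]).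
  exact: (finite_rv_prob P (fun l : {set 'I_d} => i \in l) L_rv).
have rE j : r j = \sum_(s : {set 'I_n}) (j \in s)%:R * prob P (S @^-1` [set s]).
  exact: (finite_rv_prob P (fun s : {set 'I_n} => j \in s) S_rv).
have PSE j j' : prob_matrix P S j j' =
    \sum_(s : {set 'I_n}) ((j \in s) && (j' \in s))%:R
      * prob P (S @^-1` [set s]).
  rewrite mxE.
  pose Q (s : {set 'I_n}) := (j \in s) && (j' \in s).
  exact: (finite_rv_prob P Q S_rv).
have ESO c := ESO_sum c PSE r_gt0 q_gt0 q_ESO.
have xmin : argmin (fun x => (average f x)%:E + psi x)%E xstar.
  by rewrite xstar_min.
have F_ge0 j h : 0 <= F j h.
  apply: addr_ge0; first exact: sqnorm_ge0.
  apply: mulr_ge0; first by rewrite mulr_ge0 ?sqr_ge0 ?(ltW alpha_gt0).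
  by do 2!apply: sumr_ge0 => ? _; rewrite mulr_ge0 ?invr_ge0 ?sqr_ge0.
have contr j h : prob P (past D j @^-1` [set h]) != 0 ->
    \sum_o mu o * F j.+1 (h, o) <= (1 - alpha * sigma) * F j h.
  move=> Ph.
  have step_prox o : mu o != 0 -> prox alpha psi
      ((state j h).1 - alpha *:
        grad_estimator f p r (state j h).1 (state j h).2 o.1.1 o.1.2)
      (state j.+1 (h, o)).1.
    (* The extended history has positive probability, so some outcome realises it, and there
       [svrcdg_x] provides the proximal point. *)
    move=> mo; have [w hw] : exists w, past D j.+1 w = (h, o).
      by apply: (@prob_neq0_ex _ _ _ P); rewrite PD mulf_neq0.
    have wh : past D j w = h := congr1 fst hw.
    have wo : D j w = o := congr1 snd hw.
    by rewrite -hw stateE -wh stateE -wo; exact: (svrcdg_x A).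
  have J_range := @svrcdg_state_range _ _ _ f psi alpha p r x0 m xstar j h
    f_diff f_convex f_smooth J0_range.
  have := lyapunov_contraction (ltn0Sn n') f_diff f_convex psi_proper psi_convex
    xmin f_qsc m_ge0 f_smooth (fun l => prob_ge0 P (L @^-1` [set l]))
    (fun s => prob_ge0 P (S @^-1` [set s])) (finite_rv_prob1 P L_rv)
    (finite_rv_prob1 P S_rv) (fun b => erefl (muC b)) pE rE p_gt0 r_gt0 q_gt0
    ESO sigma_gt0 rho_gt0 rho_le1 alpha_gt0 alpha_le J_range step_prox betaE.
  apply: le_trans; rewrite le_eqVlt; apply/orP; left; apply/eqP.
  apply: eq_bigr => o _; congr (_ * lyapunov _ _ _ _ _ _ _).
  by rewrite /state /=; case: (svrcdg_state _ _ _ _ _ _ h).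
have c_ge0 : 0 <= 1 - alpha * sigma by rewrite subr_ge0.
apply: le_trans (expectation_contraction (F := F) k mD PD F_ge0 c_ge0 contr) _.
rewrite lee_fin ler_wpM2r//.
apply: pow_le_of_ln_le => //.
set M := max2 _ in kge.
(* Each [den i j] is [sigma] times a value under the maximum [M], so [1 / (sigma M)] is below every
   candidate for [alpha]. *)
have aM : 1 <= alpha * sigma * M.
  have M0 : 0 < M.
    apply: (@lt_le_trans _ _ (1 / rho)); first by rewrite divr_gt0.
    apply: le_trans (le_bigmax _ _ (ord0, ord0)) => /=.
    by rewrite lerDr mulr_ge0// divr_ge0// !mulr_ge0// ltW.
  rewrite -mulrA -ler_pdivrMr ?mulr_gt0//.
  have denM i j : den i j <= sigma * M.
    pose G (i : 'I_d) (j : 'I_n) :=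
      4 * (m j i / (sigma * n%:R * p i * q j)) + 1 / rho.
    have := le_bigmax (G ord0 ord0) (fun ij => G ij.1 ij.2) (i, j).
    rewrite -(ler_pM2l sigma_gt0); apply: le_trans; rewrite le_eqVlt /den /G.
    apply/orP; left; apply/eqP; field.
    by rewrite !gt_eqF.
  have invM i j : 1 / (sigma * M) <= 1 / den i j.
    by rewrite !div1r lef_pV2 ?posrE ?mulr_gt0 ?den0.
  by apply: le_bigmin => [|ij _]; exact: invM.
have ln_ge0 : 0 <= ln (1 / eps) by rewrite ln_ge0// div1r invf_ge1// ltW.
apply: (@le_trans _ _ (alpha * sigma * (M * ln (1 / eps)))).
  by rewrite mulrA ler_peMl.
by rewrite ler_wpM2l// mulr_ge0 ?ltW.
Qed.
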